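(* Let $\Gamma$ be a subgroup of $\mathbb{C}\times\mathbb{Z}_2$ with $1\in\Gamma_0$, let $f\in\Gamma^\vee$ and $\alpha\in\mathbb{C}$. (i) The $s\mathcal{W}_\Gamma$-module $s\Omega_\Gamma(f,\alpha)$ is simple if and only if $\alpha\neq0$. (ii) The module $s\Omega_\Gamma(f,0)$ has a unique simple submodule $N$, with $N\cong\Pi(s\Omega_\Gamma(f,1/2))$ and $s\Omega_\Gamma(f,0)/N$ a trivial module.
   Context: The base field is $\mathbb{C}$. $\Gamma^\vee$ is the set of group homomorphisms $\Gamma\to\mathbb{C}^*$. For a subgroup $\Gamma\subset\mathbb{C}\times\mathbb{Z}_2$, put $\Gamma_0=\{x\in\mathbb{C}\mid(x,0)\in\Gamma\}$, $\Gamma_1=\{x\in\mathbb{C}\mid(x,1)\in\Gamma\}$; for $f\in\Gamma^\vee$, $m\in\Gamma_0$, $r\in\Gamma_1$ write $f(m)=f((m,0))$, $f(r)=f((r,1))$. $s\mathcal{W}_\Gamma$ is the Lie superalgebra whose even part has basis $\{L_m\}_{m\in\Gamma_0}$ and whose odd part has basis $\{G_r\}_{r\in\Gamma_1}$, with $[L_m,L_n]=(m-n)L_{m+n}$, $[L_m,G_r]=(\tfrac m2-r)G_{m+r}$, $[G_r,G_s]=2L_{r+s}$. Modules and submodules are $\mathbb{Z}_2$-graded and isomorphisms preserve parity. $s\Omega_\Gamma(f,\alpha)$ is the space $\mathbb{C}[L_0]\oplus\xi\mathbb{C}[L_0]$ (first summand even, second odd) with $$L_m(P(L_0)+\xi Q(L_0))=f(m)(L_0+m\alpha)P(L_0+m)+f(m)(L_0+m(\alpha+\tfrac12))\,\xi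 Q(L_0+m),$$ $$G_r(P(L_0)+\xi Q(L_0))=f(r)(L_0+2r\alpha)Q(L_0+r)+f(r)\,\xi P(L_0+r);$$ here $p(L_0)\xi q(L_0)$ means $\xi p(L_0)q(L_0)$. $\Pi$ is the parity switching functor, $\Pi(V)_{\overline i}=V_{\overline{i+1}}$. ''A trivial module'' means the one-dimensional trivial representation.
   Formalization: The formal theorem additionally assumes that Γ₁ is nonempty; if Γ₁ is empty, sΩ_Γ(f,α) is the direct sum of its nonzero even and odd parts, so (i) fails for every α≠0 and the uniqueness in (ii) fails. *)

(* Defs.v *)
From HB Require Import structures.
From mathcomp Require Import all_boot all_order all_algebra ring_quotient.
From mathcomp Require Import finmap monalg.
From mathcomp Require Import reals complex.
From mathcomp Require Import ring.

Set Implicit Arguments.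
Unset Strict Implicit.
Unset Printing Implicit Defensive.

Import GRing.Theory Num.Theory.
Local Open Scope ring_scope.
Local Open Scope quotient_scope.

Record superSpace (K : fieldType) := SuperSpace {
  evp : lmodType K;
  odp : lmodType K }.

Section SuperSpaceTotal.
Variable K : fieldType.
Implicit Type V : superSpace K.

Definition total_space V : Type := (evp V * odp V)%type.

HB.instance Definition _ V := GRing.Lmodule.copy (total_space V) (evp V * odp V)%type.

(* [homog i v]: v lies in V_i, where [false] is the parity 0 and [true] the
   parity 1; zero is homogeneous of both parities. *)
Definition homog V (i : bool) (v : total_space V) : bool :=
  if i then v.1 == 0 else v.2 == 0.

End SuperSpaceTotal.

Coercion total_space : superSpace >-> Sortclass.

Record lieSuperalgebra (K : fieldType) := LieSuperalgebra {
  lsa_space :> superSpace K;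
  brk : lsa_space -> lsa_space -> lsa_space;
  brk_linl : forall y, linear (brk^~ y);
  brk_linr : forall x, linear (brk x);
  brk_homog : forall (i j : bool) x y,
    homog i x -> homog j y -> homog (i (+) j) (brk x y);
  brk_skew : forall (i j : bool) x y, homog i x -> homog j y ->
    brk x y = - ((-1) ^+ (i && j) *: brk y x);
  brk_jacobi : forall (i j : bool) x y z, homog i x -> homog j y ->
    brk x (brk y z) = brk (brk x y) z + (-1) ^+ (i && j) *: brk y (brk x z) }.

Record smodule (K : fieldType) (g : lieSuperalgebra K) := Smodule {
  smod_space :> superSpace K;
  act : g -> smod_space -> smod_space;
  act_linl : forall v, linear (act^~ v);
  act_linr : forall x, linear (act x);
  act_homog : forall (i j : bool) x v,
    homog i x -> homog j v -> homog (i (+) j) (act x v);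
  act_brk : forall (i j : bool) x y v, homog i x -> homog j y ->
    act (brk x y) v = act x (act y v) - (-1) ^+ (i && j) *: act y (act x v) }.

(* A graded submodule is given by its even and odd components. *)
Record submodule (K : fieldType) (g : lieSuperalgebra K) (M : smodule g) :=
  Submodule {
    sub_ev : {pred evp M};
    sub_od : {pred odp M};
    sub_ev_closed : submod_closed sub_ev;
    sub_od_closed : submod_closed sub_od;
    sub_act : forall (x : g) (v : M), v.1 \in sub_ev -> v.2 \in sub_od ->
      ((act x v).1 \in sub_ev) && ((act x v).2 \in sub_od) }.

Section ModuleTheory.
Variables (K : fieldType) (g : lieSuperalgebra K).
Implicit Types M N : smodule g.

Definition mem_submod M (N : submodule M) : {pred M} :=
  [pred v : M | (v.1 \in sub_ev N) && (v.2 \in sub_od N)].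

Definition simple_smod M : Prop :=
  (exists v : M, v != 0) /\
  (forall N : submodule M,
     (forall v : M, v \in mem_submod N -> v = 0) \/
     (forall v : M, v \in mem_submod N)).

Definition iso_smod M N : Prop :=
  exists (phi0 : {linear evp M -> evp N}) (phi1 : {linear odp M -> odp N}),
    [/\ bijective phi0, bijective phi1 &
        forall (x : g) (v : M),
          (phi0 (act x v).1, phi1 (act x v).2) = act x (phi0 v.1, phi1 v.2)].

Definition trivial_smod M : Prop :=
  (exists2 e : M, e != 0 & forall v : M, exists c : K, v = c *: e) /\
  (forall (x : g) (v : M), act x v = 0).

Section Parity.
Variable M : smodule g.

Definition Pi_space : superSpace K := SuperSpace (odp M) (evp M).

Definition Pi_act (x : g) (v : Pi_space) : Pi_space :=
  let w := act x ((v.2, v.1) : M) in (w.2, w.1).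

Lemma Pi_linl v : linear (Pi_act^~ v).
Proof. by move=> c x y; rewrite /Pi_act act_linl. Qed.

Lemma Pi_linr x : linear (Pi_act x).
Proof.
move=> c u v; rewrite /Pi_act.
rewrite -[((c *: u + v).2, (c *: u + v).1)]
  /(c *: ((u.2, u.1) : M) + (v.2, v.1)).
by rewrite act_linr.
Qed.

Lemma Pi_homog (i j : bool) x v :
  homog i x -> homog j v -> homog (i (+) j) (Pi_act x v).
Proof.
move=> hx hv; have := @act_homog _ _ M i (~~ j) x (v.2, v.1) hx.
by rewrite /homog /Pi_act /=; case: i j hx hv => -[] /= _ h; apply.
Qed.

Lemma Pi_brk (i j : bool) x y v : homog i x -> homog j y ->
  Pi_act (brk x y) v =
  Pi_act x (Pi_act y v) - (-1) ^+ (i && j) *: Pi_act y (Pi_act x v).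
Proof.
move=> hx hy; rewrite /Pi_act (act_brk _ hx hy) /=.
by case: (act y _) => ? ?; case: (act x (v.2, v.1)).
Qed.

Definition Pi_smod : smodule g :=
  Smodule Pi_linl Pi_linr Pi_homog Pi_brk.

End Parity.

End ModuleTheory.

Section LmodSubQuot.
Variables (K : fieldType) (V : lmodType K) (S : {pred V}).
Hypothesis S_closed : submod_closed S.

Definition lsub_pred (_ : submod_closed S) : {pred V} := S.
Local Notation S' := (lsub_pred S_closed).

HB.instance Definition _ := GRing.isSubmodClosed.Build K V S' S_closed.

Definition lsub : Type := {v : V | v \in S'}.
HB.instance Definition _ := [isSub of lsub for @sval V _].
HB.instance Definition _ := [Choice of lsub by <:].
HB.instance Definition _ := [SubChoice_isSubLmodule of lsub by <:].

Definition lquot : Type := Quotient.quot S'.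
HB.instance Definition _ := GRing.Zmodule.on lquot.

Definition lquot_pi (v : V) : lquot := \pi_(Quotient.quot S') v.
Definition lquot_repr (q : lquot) : V := repr (q : Quotient.quot S').

Lemma lquot_reprK : cancel lquot_repr lquot_pi.
Proof. by move=> q; rewrite /lquot_pi reprK. Qed.

Lemma lquot_piP (u v : V) : (lquot_pi u == lquot_pi v) = (u - v \in S').
Proof. by rewrite Quotient.idealrBE. Qed.

Lemma lquot_repr_pi (v : V) : lquot_repr (lquot_pi v) - v \in S'.
Proof. by rewrite -lquot_piP lquot_reprK. Qed.

Definition lquot_scale (c : K) (q : lquot) : lquot := lquot_pi (c *: lquot_repr q).

Lemma lquot_piD : {morph lquot_pi : u v / u + v}.
Proof. by move=> u v; rewrite /lquot_pi /= raddfD. Qed.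

Lemma lquot_piZ c v : lquot_pi (c *: v) = lquot_scale c (lquot_pi v).
Proof.
apply/eqP; rewrite eq_sym lquot_piP -scalerBr.
exact/rpredZ/lquot_repr_pi.
Qed.

Lemma lquot_scaleA a b q : lquot_scale a (lquot_scale b q) = lquot_scale (a * b) q.
Proof. by rewrite -[q]lquot_reprK -!lquot_piZ scalerA. Qed.
Lemma lquot_scale1 : left_id 1 lquot_scale.
Proof. by move=> q; rewrite -[q]lquot_reprK -lquot_piZ scale1r. Qed.
Lemma lquot_scaleDr : right_distributive lquot_scale +%R.
Proof.
move=> c p q; rewrite -[p]lquot_reprK -[q]lquot_reprK.
by rewrite -lquot_piD -!lquot_piZ -lquot_piD scalerDr.
Qed.
Lemma lquot_scaleDl q : {morph lquot_scale^~ q : a b / a + b}.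
Proof.
by move=> a b; rewrite -[q]lquot_reprK -!lquot_piZ -lquot_piD scalerDl.
Qed.

HB.instance Definition _ := GRing.Zmodule_isLmodule.Build K lquot
  lquot_scaleA lquot_scale1 lquot_scaleDr lquot_scaleDl.

Lemma lquot_pi_is_linear : linear lquot_pi.
Proof. by move=> c u v; rewrite lquot_piD lquot_piZ. Qed.
HB.instance Definition _ := GRing.isLinear.Build K V lquot *:%R lquot_pi
  lquot_pi_is_linear.

End LmodSubQuot.

Section SubQuotient.
Variables (K : fieldType) (g : lieSuperalgebra K) (M : smodule g).
Variable N : submodule M.

Definition sub_space : superSpace K :=
  SuperSpace (lsub (sub_ev_closed N)) (lsub (sub_od_closed N)).

Definition sub_incl (v : sub_space) : M := (sval v.1, sval v.2).

Lemma sub_incl_inj : injective sub_incl.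
Proof. by case=> [a b] [c d] [/val_inj -> /val_inj ->]. Qed.

Lemma sub_incl_linear : linear sub_incl.
Proof. by []. Qed.

Lemma sub_act_proof (x : g) (v : sub_space) :
  ((act x (sub_incl v)).1 \in sub_ev N) && ((act x (sub_incl v)).2 \in sub_od N).
Proof. by apply: sub_act; [exact: (valP v.1) | exact: (valP v.2)]. Qed.

Definition sub_smod_act (x : g) (v : sub_space) : sub_space :=
  (exist _ (act x (sub_incl v)).1 (proj1 (andP (sub_act_proof x v))),
   exist _ (act x (sub_incl v)).2 (proj2 (andP (sub_act_proof x v)))).

Lemma sub_smod_actE x v : sub_incl (sub_smod_act x v) = act x (sub_incl v).
Proof. by rewrite /sub_incl /=; case: (act x _). Qed.

Lemma sub_smod_linl v : linear (sub_smod_act^~ v).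
Proof.
move=> c x y; apply: sub_incl_inj.
by rewrite sub_incl_linear !sub_smod_actE act_linl.
Qed.

Lemma sub_smod_linr x : linear (sub_smod_act x).
Proof.
move=> c u v; apply: sub_incl_inj.
by rewrite sub_incl_linear !sub_smod_actE sub_incl_linear act_linr.
Qed.

Lemma sub_incl_homog i v : homog i (sub_incl v) = homog i v.
Proof. by case: i v => -[a b]; rewrite /homog /= -val_eqE. Qed.

Lemma sub_smod_homog (i j : bool) x v :
  homog i x -> homog j v -> homog (i (+) j) (sub_smod_act x v).
Proof.
move=> hx hv; rewrite -sub_incl_homog sub_smod_actE.
by apply: act_homog => //; rewrite sub_incl_homog.
Qed.

Lemma sub_smod_brk (i j : bool) x y v : homog i x -> homog j y ->
  sub_smod_act (brk x y) v = sub_smod_act x (sub_smod_act y v)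
    - (-1) ^+ (i && j) *: sub_smod_act y (sub_smod_act x v).
Proof.
move=> hx hy; apply: sub_incl_inj.
by rewrite addrC -scaleNr sub_incl_linear !sub_smod_actE (act_brk _ hx hy)
  addrC scaleNr.
Qed.

Definition sub_smod : smodule g :=
  Smodule sub_smod_linl sub_smod_linr sub_smod_homog sub_smod_brk.

Definition quot_space : superSpace K :=
  SuperSpace (lquot (sub_ev_closed N)) (lquot (sub_od_closed N)).

Definition quot_pi (v : M) : quot_space :=
  (lquot_pi (sub_ev_closed N) v.1, lquot_pi (sub_od_closed N) v.2).

Definition quot_repr (q : quot_space) : M :=
  (lquot_repr q.1, lquot_repr q.2).

Definition quot_smod_act (x : g) (q : quot_space) : quot_space :=
  quot_pi (act x (quot_repr q)).

Lemma quot_reprK : cancel quot_repr quot_pi.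
Proof. by case=> a b; rewrite /quot_pi /= !lquot_reprK. Qed.

Lemma quot_pi_linear : linear quot_pi.
Proof. by move=> c u v; rewrite /quot_pi !linearP. Qed.

Lemma quot_smod_actE x v : quot_smod_act x (quot_pi v) = quot_pi (act x v).
Proof.
rewrite /quot_smod_act; have [w -> [w1 w2]] : exists2 w, quot_repr (quot_pi v) = w + v &
    w.1 \in sub_ev N /\ w.2 \in sub_od N.
  exists (quot_repr (quot_pi v) - v); first by rewrite subrK.
  by split; apply: lquot_repr_pi.
rewrite -[w]scale1r act_linr quot_pi_linear scale1r.
have /andP[h1 h2] := sub_act x w1 w2.
rewrite [X in X + _](_ : _ = 0) ?add0r //; congr pair; apply/eqP.
  by rewrite -(raddf0 (lquot_pi (sub_ev_closed N))) lquot_piP subr0.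
by rewrite -(raddf0 (lquot_pi (sub_od_closed N))) lquot_piP subr0.
Qed.

Lemma quot_smod_linl v : linear (quot_smod_act^~ v).
Proof.
by move=> c x y; rewrite /quot_smod_act act_linl quot_pi_linear.
Qed.

Lemma quot_smod_linr x : linear (quot_smod_act x).
Proof.
move=> c u v; rewrite -[u]quot_reprK -[v]quot_reprK -quot_pi_linear.
by rewrite !quot_smod_actE act_linr quot_pi_linear.
Qed.

Lemma quot_homog i q : homog i q -> exists2 v, homog i v & quot_pi v = q.
Proof.
case: i q => -[a b] /= /eqP /= ->.
  exists (0, lquot_repr b); first by rewrite /homog /=.
  by rewrite /quot_pi /= raddf0 lquot_reprK.
exists (lquot_repr a, 0); first by rewrite /homog /=.
by rewrite /quot_pi /= raddf0 lquot_reprK.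
Qed.

Lemma quot_pi_homog i v : homog i v -> homog i (quot_pi v).
Proof. by case: i v => -[a b]; rewrite /homog /= => /eqP ->; rewrite raddf0. Qed.

Lemma quot_smod_homog (i j : bool) x v :
  homog i x -> homog j v -> homog (i (+) j) (quot_smod_act x v).
Proof.
move=> hx /quot_homog[w hw <-]; rewrite quot_smod_actE.
exact/quot_pi_homog/act_homog.
Qed.

Lemma quot_smod_brk (i j : bool) x y v : homog i x -> homog j y ->
  quot_smod_act (brk x y) v = quot_smod_act x (quot_smod_act y v)
    - (-1) ^+ (i && j) *: quot_smod_act y (quot_smod_act x v).
Proof.
move=> hx hy; rewrite -[v]quot_reprK !quot_smod_actE (act_brk _ hx hy).
by rewrite addrC -scaleNr quot_pi_linear addrC scaleNr.
Qed.

Definition quot_smod : smodule g :=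
  Smodule quot_smod_linl quot_smod_linr quot_smod_homog quot_smod_brk.

End SubQuotient.

Section LinearExtension.
Variables (K : fieldType) (T : choiceType).

Definition lext (V : lmodType K) (h : T -> V) (u : {malg K[T]}) : V :=
  \sum_(k <- msupp u) u@_k *: h k.

Lemma lextwE (V : lmodType K) (h : T -> V) (d : {fset T}) (u : {malg K[T]}) :
  (msupp u `<=` d)%fset -> lext h u = \sum_(k <- d) u@_k *: h k.
Proof.
move=> le_d; rewrite /lext (big_fset_incl _ le_d) // => k _ /mcoeff_outdom ->.
by rewrite scale0r.
Qed.

Lemma lext_linear (V : lmodType K) (h : T -> V) : linear (lext h).
Proof.
move=> c u v; pose d := (msupp u `|` msupp v)%fset.
rewrite (@lextwE _ h d (c *: u + v)); last first.
  by apply: fsubset_trans (msuppD_le _ _) _; apply: fsetSU; exact: msuppZ_le.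
rewrite (@lextwE _ h d u) ?fsubsetUl // (@lextwE _ h d v) ?fsubsetUr //.
rewrite scaler_sumr -big_split /=; apply: eq_bigr => k _.
by rewrite mcoeffD mcoeffZ scalerDl scalerA.
Qed.
HB.instance Definition _ (V : lmodType K) (h : T -> V) := GRing.isLinear.Build K {malg K[T]} V *:%R
  (@lext V h) (@lext_linear V h).

Lemma lextU (V : lmodType K) (h : T -> V) k : lext h << k >> = h k.
Proof.
by rewrite (lextwE _ msuppU_le) big_seq_fset1 mcoeffUU scale1r.
Qed.

Lemma malg_ext (V : lmodType K) (F G : {malg K[T]} -> V) :
  linear F -> linear G -> (forall k, F << k >> = G << k >>) -> F =1 G.
Proof.
move=> linF linG FG u.
pose isF := GRing.isLinear.Build K {malg K[T]} V *:%R F linF.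
pose isG := GRing.isLinear.Build K {malg K[T]} V *:%R G linG.
pose F' : {linear {malg K[T]} -> V} := HB.pack F isF.
pose G' : {linear {malg K[T]} -> V} := HB.pack G isG.
rewrite -[F]/(F' : _ -> _) -[G]/(G' : _ -> _) [u]monalgE !linear_sum.
apply: eq_bigr => k _.
have -> : << u@_k *g k >> = u@_k *: << k >> :> {malg K[T]}.
  by apply/malgP=> l; rewrite mcoeffZ !mcoeffU mulr_natr.
by rewrite !linearZ /= FG.
Qed.

End LinearExtension.

Section LinearProps.
Variable K : fieldType.

Lemma lin0 (U V : lmodType K) (F : U -> V) : linear F -> F 0 = 0.
Proof. by move=> /(_ (-1) 0 0); rewrite scaler0 addr0 scaleN1r addNr. Qed.

Lemma linZ (U V : lmodType K) (F : U -> V) :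
  linear F -> forall c x, F (c *: x) = c *: F x.
Proof. by move=> linF c x; have := linF c x 0; rewrite (lin0 linF) !addr0. Qed.

Lemma lin_comp (U V W : lmodType K) (F : V -> W) (G : U -> V) :
  linear F -> linear G -> linear (fun x => F (G x)).
Proof. by move=> linF linG c u v; rewrite linG linF. Qed.
Lemma lin_add (U V : lmodType K) (F G : U -> V) :
  linear F -> linear G -> linear (fun x => F x + G x).
Proof.
by move=> linF linG c u v; rewrite linG linF scalerDr addrACA.
Qed.
Lemma lin_zero (U V : lmodType K) : linear (fun _ : U => 0 : V).
Proof. by move=> c u v; rewrite scaler0 addr0. Qed.
Lemma lin_opp (U V : lmodType K) (F : U -> V) :
  linear F -> linear (fun x => - F x).
Proof. by move=> linF c u v; rewrite linF opprD scalerN. Qed.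

End LinearProps.

Section Assemble.
Variables (K : fieldType) (V0 V1 : lmodType K).
Variables (LL : V0 -> V0 -> V0) (LG : V0 -> V1 -> V1) (GG : V1 -> V1 -> V0).
Hypotheses (LL_l : forall y, linear (LL^~ y)) (LL_r : forall x, linear (LL x)).
Hypotheses (LG_l : forall y, linear (LG^~ y)) (LG_r : forall x, linear (LG x)).
Hypotheses (GG_l : forall y, linear (GG^~ y)) (GG_r : forall x, linear (GG x)).
Hypotheses (LL_anti : forall x y, LL x y = - LL y x).
Hypotheses (GG_sym : forall x y, GG x y = GG y x).
Hypothesis jac000 : forall x y z, LL x (LL y z) = LL (LL x y) z + LL y (LL x z).
Hypothesis jac001 : forall x y z, LG x (LG y z) = LG (LL x y) z + LG y (LG x z).
Hypothesis jac011 : forall x y z, LL x (GG y z) = GG (LG x y) z + GG y (LG x z).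
Hypothesis jac111 : forall x y z, LG (GG y z) x + LG (GG x y) z + LG (GG x z) y = 0.

Let W := SuperSpace V0 V1.
Definition asm_brk (x y : W) : W :=
  (LL x.1 y.1 + GG x.2 y.2, LG x.1 y.2 - LG y.1 x.2).

Let Dl := (LL_l, LG_l, GG_l).
Let Dr := (LL_r, LG_r, GG_r).

Let z1 y : LL 0 y = 0. Proof. exact: (lin0 (LL_l y)). Qed.
Let z2 y : LL y 0 = 0. Proof. exact: (lin0 (LL_r y)). Qed.
Let z3 y : LG 0 y = 0. Proof. exact: (lin0 (LG_l y)). Qed.
Let z4 y : LG y 0 = 0. Proof. exact: (lin0 (LG_r y)). Qed.
Let z5 y : GG 0 y = 0. Proof. exact: (lin0 (GG_l y)). Qed.
Let z6 y : GG y 0 = 0. Proof. exact: (lin0 (GG_r y)). Qed.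
Let z := (z1, z2, z3, z4, z5, z6, addr0, add0r, subr0, sub0r, oppr0).
Let LGN x y : LG x (- y) = - LG x y.
Proof. by rewrite -scaleN1r (linZ (LG_r x)) scaleN1r. Qed.
Let GGN x y : GG x (- y) = - GG x y.
Proof. by rewrite -scaleN1r (linZ (GG_r x)) scaleN1r. Qed.
Let GGNl x y : GG (- x) y = - GG x y.
Proof. by rewrite -scaleN1r (linZ (GG_l y)) scaleN1r. Qed.

Lemma asm_linl y : linear (asm_brk^~ y).
Proof.
move=> c u v; rewrite /asm_brk /= !(Dl, Dr).
by congr pair => /=; rewrite ?opprD ?scalerDr ?scalerN addrACA.
Qed.

Lemma asm_linr x : linear (asm_brk x).
Proof.
move=> c u v; rewrite /asm_brk /= !(Dl, Dr).
by congr pair => /=; rewrite ?opprD ?scalerDr ?scalerN addrACA.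
Qed.

Lemma asm_homog (i j : bool) x y :
  homog i x -> homog j y -> homog (i (+) j) (asm_brk x y).
Proof.
by case: i j x y => -[] [a b] [c d]; rewrite /homog /asm_brk /= => /eqP-> /eqP->;
  rewrite !z.
Qed.

Lemma asm_skew (i j : bool) x y : homog i x -> homog j y ->
  asm_brk x y = - ((-1) ^+ (i && j) *: asm_brk y x).
Proof.
case: i j x y => -[] [a b] [c d]; rewrite /homog /asm_brk /= => /eqP-> /eqP->;
  rewrite ?expr0 ?expr1 ?scaleN1r ?scale1r ?opprK; congr pair;
  rewrite /= ?z ?opprK //.
Qed.

Lemma asm_jacobi (i j : bool) x y t : homog i x -> homog j y ->
  asm_brk x (asm_brk y t) =
  asm_brk (asm_brk x y) t + (-1) ^+ (i && j) *: asm_brk y (asm_brk x t).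
Proof.
case: i j x y t => -[] [a b] [c d] [e f]; rewrite /homog /asm_brk /= => /eqP-> /eqP->;
  rewrite ?expr0 ?expr1 ?scaleN1r ?scale1r; congr pair; rewrite /= ?z ?(LGN, GGN, GGNl) ?opprK //.
- by rewrite LL_anti jac011 (GG_sym d) opprD addrAC addNr add0r.
- have /eqP := jac111 b d f; rewrite -addrA addr_eq0 => /eqP ->.
  by rewrite opprK.
- by rewrite jac011 addKr.
- by rewrite (jac001 c e b) opprD addrCA subrr addr0.
- by rewrite (jac001 a e d) opprD addrC.
Qed.

End Assemble.

Section AssembleModule.
Variables (K : fieldType) (V0 V1 : lmodType K).
Variables (LL : V0 -> V0 -> V0) (LG : V0 -> V1 -> V1) (GG : V1 -> V1 -> V0).
Hypotheses (LL_l : forall y, linear (LL^~ y)) (LL_r : forall x, linear (LL x)).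
Hypotheses (LG_l : forall y, linear (LG^~ y)) (LG_r : forall x, linear (LG x)).
Hypotheses (GG_l : forall y, linear (GG^~ y)) (GG_r : forall x, linear (GG x)).
Variable V : superSpace K.
Variables (EL : V0 -> V -> V) (EG : V1 -> V -> V).
Hypotheses (EL_l : forall v, linear (EL^~ v)) (EL_r : forall x, linear (EL x)).
Hypotheses (EG_l : forall v, linear (EG^~ v)) (EG_r : forall x, linear (EG x)).
Hypothesis EL_homog : forall j a v, homog j v -> homog j (EL a v).
Hypothesis EG_homog : forall j b v, homog j v -> homog (~~ j) (EG b v).
Hypothesis EL_LL : forall x y v, EL (LL x y) v = EL x (EL y v) - EL y (EL x v).
Hypothesis EG_LG : forall x y v, EG (LG x y) v = EL x (EG y v) - EG y (EL x v).
Hypothesis EL_GG : forall x y v, EL (GG x y) v = EG x (EG y v) + EG y (EG x v).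

Let W := SuperSpace V0 V1.
Definition asm_act (x : W) (v : V) : V := EL x.1 v + EG x.2 v.

Lemma asm_act_linl v : linear (asm_act^~ v).
Proof.
by move=> c x y; rewrite /asm_act /= EL_l EG_l scalerDr addrACA.
Qed.

Lemma asm_act_linr x : linear (asm_act x).
Proof.
by move=> c u v; rewrite /asm_act EL_r EG_r scalerDr addrACA.
Qed.

Lemma asm_act_homog (i j : bool) x v :
  homog i x -> homog j v -> homog (i (+) j) (asm_act x v).
Proof.
case: i x => -[a b] /= /eqP /= -> hv; rewrite /asm_act /=.
  by rewrite (lin0 (EL_l v)) add0r; exact: EG_homog.
by rewrite (lin0 (EG_l v)) addr0; exact: EL_homog.
Qed.

Lemma asm_act_brk (i j : bool) x y v : homog i x -> homog j y ->
  asm_act (asm_brk LL LG GG x y) v =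
  asm_act x (asm_act y v) - (-1) ^+ (i && j) *: asm_act y (asm_act x v).
Proof.
have EL0 u : EL 0 u = 0 by exact: (lin0 (EL_l u)).
have EG0 u : EG 0 u = 0 by exact: (lin0 (EG_l u)).
have EGN b u : EG (- b) u = - EG b u.
  by rewrite -scaleN1r (linZ (EG_l u)) scaleN1r.
have z1 y' : LL 0 y' = 0 by exact: (lin0 (LL_l y')).
have z2 y' : LL y' 0 = 0 by exact: (lin0 (LL_r y')).
have z3 y' : LG 0 y' = 0 by exact: (lin0 (LG_l y')).
have z4 y' : LG y' 0 = 0 by exact: (lin0 (LG_r y')).
have z5 y' : GG 0 y' = 0 by exact: (lin0 (GG_l y')).
have z6 y' : GG y' 0 = 0 by exact: (lin0 (GG_r y')).
case: i j x y => -[] [a b] [c d]; rewrite /homog /asm_act /= => /eqP-> /eqP->;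
  rewrite ?expr0 ?expr1 ?scaleN1r ?scale1r /=
    ?(z1, z2, z3, z4, z5, z6, EL0, EG0, add0r, addr0, sub0r, subr0, oppr0) ?opprK.
- exact: EL_GG.
- by rewrite EGN EG_LG opprB.
- exact: EG_LG.
- exact: EL_LL.
Qed.

End AssembleModule.

Section BasisJacobi.
Variables (K : numFieldType) (V0 V1 : lmodType K) (I0 I1 : Type).
Variables (v0 : I0 -> K) (v1 : I1 -> K) (bL : I0 -> V0) (bG : I1 -> V1).
Variables (a00 : I0 -> I0 -> I0) (a01 : I0 -> I1 -> I1) (a11 : I1 -> I1 -> I0).
Hypotheses (a00E : forall m n, v0 (a00 m n) = v0 m + v0 n).
Hypotheses (a01E : forall m n, v1 (a01 m n) = v0 m + v1 n).
Hypotheses (a11E : forall m n, v0 (a11 m n) = v1 m + v1 n).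
Hypotheses (v0_inj : injective v0) (v1_inj : injective v1).
Variables (LL : V0 -> V0 -> V0) (LG : V0 -> V1 -> V1) (GG : V1 -> V1 -> V0).
Hypotheses (LL_l : forall y, linear (LL^~ y)) (LL_r : forall x, linear (LL x)).
Hypotheses (LG_l : forall y, linear (LG^~ y)) (LG_r : forall x, linear (LG x)).
Hypotheses (GG_l : forall y, linear (GG^~ y)) (GG_r : forall x, linear (GG x)).
Hypothesis LLU : forall m n, LL (bL m) (bL n) = (v0 m - v0 n) *: bL (a00 m n).
Hypothesis LGU : forall m r, LG (bL m) (bG r) = (v0 m / 2 - v1 r) *: bG (a01 m r).
Hypothesis GGU : forall r s, GG (bG r) (bG s) = 2 *: bL (a11 r s).

Let LLZl c x y : LL (c *: x) y = c *: LL x y. Proof. exact: (linZ (LL_l y)). Qed.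
Let LGZl c x y : LG (c *: x) y = c *: LG x y. Proof. exact: (linZ (LG_l y)). Qed.
Let GGZl c x y : GG (c *: x) y = c *: GG x y. Proof. exact: (linZ (GG_l y)). Qed.
Let LLZr c x y : LL x (c *: y) = c *: LL x y. Proof. exact: (linZ (LL_r x)). Qed.
Let LGZr c x y : LG x (c *: y) = c *: LG x y. Proof. exact: (linZ (LG_r x)). Qed.
Let GGZr c x y : GG x (c *: y) = c *: GG x y. Proof. exact: (linZ (GG_r x)). Qed.
Let brkE := (LLU, LGU, GGU, (LLZl, LGZl, GGZl), (LLZr, LGZr, GGZr)).
Let valE := (a00E, a01E, a11E).

Lemma basis_anti m n : LL (bL m) (bL n) = - LL (bL n) (bL m).
Proof.
rewrite !LLU -scaleNr opprB; congr (_ *: bL _).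
by apply: v0_inj; rewrite !a00E addrC.
Qed.

Lemma basis_sym m n : GG (bG m) (bG n) = GG (bG n) (bG m).
Proof.
by rewrite !GGU; congr (_ *: bL _); apply: v0_inj; rewrite !a11E addrC.
Qed.

Lemma basis000 m n p : LL (bL m) (LL (bL n) (bL p)) =
  LL (LL (bL m) (bL n)) (bL p) + LL (bL n) (LL (bL m) (bL p)).
Proof.
rewrite !brkE !scalerA.
have -> : a00 (a00 m n) p = a00 m (a00 n p).
  by apply: v0_inj; rewrite !valE addrA.
have -> : a00 n (a00 m p) = a00 m (a00 n p).
  by apply: v0_inj; rewrite !valE addrCA.
by rewrite -scalerDl; congr (_ *: _); rewrite !valE; ring.
Qed.

Lemma basis001 m n p : LG (bL m) (LG (bL n) (bG p)) =
  LG (LL (bL m) (bL n)) (bG p) + LG (bL n) (LG (bL m) (bG p)).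
Proof.
rewrite !brkE !scalerA.
have -> : a01 (a00 m n) p = a01 m (a01 n p).
  by apply: v1_inj; rewrite !valE addrA.
have -> : a01 n (a01 m p) = a01 m (a01 n p).
  by apply: v1_inj; rewrite !valE addrCA.
by rewrite -scalerDl; congr (_ *: _); rewrite !valE; field.
Qed.

Lemma basis011 m n p : LL (bL m) (GG (bG n) (bG p)) =
  GG (LG (bL m) (bG n)) (bG p) + GG (bG n) (LG (bL m) (bG p)).
Proof.
rewrite !brkE !scalerA.
have -> : a11 (a01 m n) p = a00 m (a11 n p).
  by apply: v0_inj; rewrite !valE addrA.
have -> : a11 n (a01 m p) = a00 m (a11 n p).
  by apply: v0_inj; rewrite !valE addrCA.
by rewrite -scalerDl; congr (_ *: _); rewrite !valE; field.
Qed.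

Lemma basis111 m n p : LG (GG (bG n) (bG p)) (bG m) +
  LG (GG (bG m) (bG n)) (bG p) + LG (GG (bG m) (bG p)) (bG n) = 0.
Proof.
rewrite !brkE !scalerA.
have -> : a01 (a11 m n) p = a01 (a11 n p) m.
  by apply: v1_inj; rewrite !valE -addrA addrC.
have -> : a01 (a11 m p) n = a01 (a11 n p) m.
  by apply: v1_inj; rewrite !valE addrC addrCA addrC.
rewrite -!scalerDl [X in X *: _](_ : _ = 0) ?scale0r // !valE.
by field.
Qed.

End BasisJacobi.

Section PolyIdentities.
Variable K : numFieldType.

Definition shift_poly (c : K) (P : {poly K}) : {poly K} := P \Po ('X + c%:P).

Lemma shift_poly_linear c : linear (shift_poly c).
Proof. by move=> a P Q; rewrite /shift_poly linearP. Qed.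
HB.instance Definition _ c :=
  GRing.isLinear.Build K {poly K} {poly K} *:%R (shift_poly c)
    (shift_poly_linear c).

Lemma shift_polyD a b P : shift_poly a (shift_poly b P) = shift_poly (a + b) P.
Proof.
rewrite /shift_poly -comp_polyA comp_polyD comp_polyX comp_polyC -addrA.
by rewrite polyCD.
Qed.

Lemma shift_polyM a P Q :
  shift_poly a (P * Q) = shift_poly a P * shift_poly a Q.
Proof. exact: comp_polyM. Qed.

Lemma shift_lin a b : shift_poly a ('X + b%:P) = 'X + a%:P + b%:P.
Proof. by rewrite /shift_poly comp_polyD comp_polyX comp_polyC. Qed.

Definition wop (c a m : K) (P : {poly K}) : {poly K} :=
  c *: (('X + a%:P) * shift_poly m P).

Lemma wop_linear c a m : linear (wop c a m).
Proof.
move=> b P Q; rewrite /wop linearP mulrDr scalerDr; congr (_ + _).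
by rewrite -scalerAr !scalerA mulrC.
Qed.

Definition sclop (c m : K) (P : {poly K}) : {poly K} := c *: shift_poly m P.

Lemma sclop_linear c m : linear (sclop c m).
Proof.
by move=> b P Q; rewrite /sclop linearP scalerDr; congr (_ + _); rewrite !scalerA mulrC.
Qed.

Lemma wopE c a m P : wop c a m P = c%:P * (('X + a%:P) * shift_poly m P).
Proof. by rewrite mul_polyC. Qed.
Lemma sclopE c m P : sclop c m P = c%:P * shift_poly m P.
Proof. by rewrite mul_polyC. Qed.
Lemma shift_polyC m c : shift_poly m c%:P = c%:P.
Proof. exact: comp_polyC. Qed.

Let half_eq (m : K) : m = 2 * (m / 2). Proof. by field. Qed.
Let half_mul (m a : K) : 2 * m * (a + 1 / 2) = 2 * m * a + m.
Proof. by field. Qed.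

Ltac polyid := rewrite ?(wopE, sclopE) ?(shift_polyM, shift_lin, shift_polyD, shift_polyC) -?mul_polyC.

Lemma omega_LL (c d m n a : K) P :
  (m - n) *: wop (c * d) ((m + n) * a) (m + n) P =
  wop c (m * a) m (wop d (n * a) n P) - wop d (n * a) n (wop c (m * a) m P).
Proof.
by polyid; rewrite (addrC n m); ring.
Qed.

Lemma omega_LG0 (c d m r a : K) P :
  (m / 2 - r) *: wop (c * d) (2 * (m + r) * a) (m + r) P =
  wop c (m * a) m (wop d (2 * r * a) r P)
  - wop d (2 * r * a) r (wop c (m * (a + 1 / 2)) m P).
Proof.
have mE := half_eq m; move: (m / 2) mE => k ->; rewrite half_mul.
by polyid; rewrite (addrC r); ring.
Qed.

Lemma omega_LG1 (c d m r a : K) P :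
  (m / 2 - r) *: sclop (c * d) (m + r) P =
  wop c (m * (a + 1 / 2)) m (sclop d r P) - sclop d r (wop c (m * a) m P).
Proof.
have mE := half_eq m; move: (m / 2) mE => k ->; rewrite half_mul.
by polyid; rewrite (addrC r); ring.
Qed.

Lemma omega_GG0 (c d r s a : K) P :
  2 *: wop (c * d) ((r + s) * a) (r + s) P =
  wop c (2 * r * a) r (sclop d s P) + wop d (2 * s * a) s (sclop c r P).
Proof. by polyid; rewrite (addrC s r); ring. Qed.

Lemma omega_GG1 (c d r s a : K) P :
  2 *: wop (c * d) ((r + s) * (a + 1 / 2)) (r + s) P =
  sclop c r (wop d (2 * s * a) s P) + sclop d s (wop c (2 * r * a) r P).
Proof.
rewrite (half_eq r) (half_eq s) -mulrDr half_mul.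
move: (r / 2) (s / 2) => k l.
by polyid; rewrite (addrC (2 * l)) -mulrDr; ring.
Qed.

End PolyIdentities.
Section SWitt.
Variables (K : numFieldType) (Gam : zmodClosed (K * 'Z_2)%type).

(* Gamma_0 and Gamma_1 are [gam 0] and [gam 1]. *)
Definition gam (i : 'Z_2) : Type := {x : K | (x, i) \in Gam}.
HB.instance Definition _ i := [isSub of gam i for @sval K _].
HB.instance Definition _ i := [Choice of gam i by <:].

Lemma gam_add_proof i j k : i + j = k ->
  forall (m : gam i) (n : gam j), (val m + val n, k) \in Gam.
Proof. by move=> <- m n; exact: (rpredD (valP m) (valP n)). Qed.

Definition gam_add i j k (e : i + j = k) (m : gam i) (n : gam j) : gam k :=
  Sub (val m + val n) (gam_add_proof e m n).

Lemma gam11_proof : 1 + 1 = 0 :> 'Z_2. Proof. exact: val_inj. Qed.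

Definition add00 : gam 0 -> gam 0 -> gam 0 := gam_add (addr0 0).
Definition add01 : gam 0 -> gam 1 -> gam 1 := gam_add (add0r 1).
Definition add11 : gam 1 -> gam 1 -> gam 0 := gam_add gam11_proof.

Lemma add00E m n : val (add00 m n) = val m + val n. Proof. by []. Qed.
Lemma add01E m n : val (add01 m n) = val m + val n. Proof. by []. Qed.
Lemma add11E m n : val (add11 m n) = val m + val n. Proof. by []. Qed.

Definition sw_space : superSpace K :=
  SuperSpace {malg K[gam 0]} {malg K[gam 1]}.

Definition brkLL : {malg K[gam 0]} -> {malg K[gam 0]} -> {malg K[gam 0]} :=
  fun x y => lext (fun m => lext (fun n =>
    (val m - val n) *: << add00 m n >>) y) x.

Definition brkLG : {malg K[gam 0]} -> {malg K[gam 1]} -> {malg K[gam 1]} :=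
  fun x y => lext (fun m => lext (fun r =>
    (val m / 2 - val r) *: << add01 m r >>) y) x.

Definition brkGG : {malg K[gam 1]} -> {malg K[gam 1]} -> {malg K[gam 0]} :=
  fun x y => lext (fun r => lext (fun s => 2 *: << add11 r s >>) y) x.

(* The bracket [G_r, L_m] is - [L_m, G_r]. *)
Definition sw_brk (x y : sw_space) : sw_space :=
  (brkLL x.1 y.1 + brkGG x.2 y.2, brkLG x.1 y.2 - brkLG y.1 x.2).

Lemma lext2_linr (T1 T2 : choiceType) (V : lmodType K) (h : T1 -> T2 -> V) x :
  linear (fun y => lext (fun m => lext (h m) y) x).
Proof.
move=> c u v; rewrite /lext scaler_sumr -big_split; apply: eq_bigr => k _ /=.
by rewrite -!/(lext (h k) _) linearP scalerDr !scalerA mulrC.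
Qed.

Lemma brkLL_l y : linear (brkLL^~ y). Proof. exact: lext_linear. Qed.
Lemma brkLL_r x : linear (brkLL x). Proof. exact: lext2_linr. Qed.
Lemma brkLG_l y : linear (brkLG^~ y). Proof. exact: lext_linear. Qed.
Lemma brkLG_r x : linear (brkLG x). Proof. exact: lext2_linr. Qed.
Lemma brkGG_l y : linear (brkGG^~ y). Proof. exact: lext_linear. Qed.
Lemma brkGG_r x : linear (brkGG x). Proof. exact: lext2_linr. Qed.

Lemma brkLLU m n : brkLL << m >> << n >> = (val m - val n) *: << add00 m n >>.
Proof. by rewrite /brkLL !lextU. Qed.
Lemma brkLGU m r : brkLG << m >> << r >> = (val m / 2 - val r) *: << add01 m r >>.
Proof. by rewrite /brkLG !lextU. Qed.
Lemma brkGGU r s : brkGG << r >> << s >> = 2 *: << add11 r s >>.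
Proof. by rewrite /brkGG !lextU. Qed.

Lemma brkLL_anti x y : brkLL x y = - brkLL y x.
Proof.
move: x; apply: malg_ext (brkLL_l y) (lin_opp (brkLL_r y)) _ => m.
move: y; apply: malg_ext (brkLL_r _) (lin_opp (brkLL_l _)) _ => n.
exact: (basis_anti (bL := fun m => << m >>) add00E val_inj brkLLU).
Qed.

Lemma brkGG_sym x y : brkGG x y = brkGG y x.
Proof.
move: x; apply: malg_ext (brkGG_l y) (brkGG_r y) _ => m.
move: y; apply: malg_ext (brkGG_r _) (brkGG_l _) _ => n.
exact: (basis_sym (bL := fun m => << m >>) (bG := fun m => << m >>)
          add11E val_inj brkGGU).
Qed.

Lemma sw_jac000 x y z :
  brkLL x (brkLL y z) = brkLL (brkLL x y) z + brkLL y (brkLL x z).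
Proof.
move: x; apply: malg_ext (brkLL_l _) (lin_add (lin_comp (brkLL_l z) (brkLL_l y))
  (lin_comp (brkLL_r y) (brkLL_l z))) _ => m.
move: y; apply: malg_ext (lin_comp (brkLL_r _) (brkLL_l z))
  (lin_add (lin_comp (brkLL_l z) (brkLL_r _)) (brkLL_l _)) _ => n.
move: z; apply: malg_ext (lin_comp (brkLL_r _) (brkLL_r _))
  (lin_add (brkLL_r _) (lin_comp (brkLL_r _) (brkLL_r _))) _ => p.
exact: (basis000 (bL := fun m => << m >>) add00E val_inj
          brkLL_l brkLL_r brkLLU).
Qed.

Lemma sw_jac001 x y z :
  brkLG x (brkLG y z) = brkLG (brkLL x y) z + brkLG y (brkLG x z).
Proof.
move: x; apply: malg_ext (brkLG_l _) (lin_add (lin_comp (brkLG_l z) (brkLL_l y))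
  (lin_comp (brkLG_r y) (brkLG_l z))) _ => m.
move: y; apply: malg_ext (lin_comp (brkLG_r _) (brkLG_l z))
  (lin_add (lin_comp (brkLG_l z) (brkLL_r _)) (brkLG_l _)) _ => n.
move: z; apply: malg_ext (lin_comp (brkLG_r _) (brkLG_r _))
  (lin_add (brkLG_r _) (lin_comp (brkLG_r _) (brkLG_r _))) _ => p.
exact: (basis001 (bL := fun m => << m >>) (bG := fun r => << r >>)
          add00E add01E val_inj brkLG_l brkLG_r brkLLU brkLGU).
Qed.

Lemma sw_jac011 x y z :
  brkLL x (brkGG y z) = brkGG (brkLG x y) z + brkGG y (brkLG x z).
Proof.
move: x; apply: malg_ext (brkLL_l _) (lin_add (lin_comp (brkGG_l z) (brkLG_l y))
  (lin_comp (brkGG_r y) (brkLG_l z))) _ => m.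
move: y; apply: malg_ext (lin_comp (brkLL_r _) (brkGG_l z))
  (lin_add (lin_comp (brkGG_l z) (brkLG_r _)) (brkGG_l _)) _ => n.
move: z; apply: malg_ext (lin_comp (brkLL_r _) (brkGG_r _))
  (lin_add (brkGG_r _) (lin_comp (brkGG_r _) (brkLG_r _))) _ => p.
exact: (basis011 (bL := fun m => << m >>) (bG := fun r => << r >>)
          add00E add01E add11E val_inj brkLL_r brkGG_l brkGG_r brkLLU brkLGU
          brkGGU).
Qed.

Lemma sw_jac111 x y z :
  brkLG (brkGG y z) x + brkLG (brkGG x y) z + brkLG (brkGG x z) y = 0.
Proof.
move: x; apply: malg_ext (lin_add (lin_add (brkLG_r _)
  (lin_comp (brkLG_l z) (brkGG_l y))) (lin_comp (brkLG_l y) (brkGG_l z)))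
  (@lin_zero _ _ _) _ => m.
move: y; apply: malg_ext (lin_add (lin_add (lin_comp (brkLG_l _) (brkGG_l z))
  (lin_comp (brkLG_l z) (brkGG_r _))) (brkLG_r _)) (@lin_zero _ _ _) _ => n.
move: z; apply: malg_ext (lin_add (lin_add (lin_comp (brkLG_l _) (brkGG_r _))
  (brkLG_r _)) (lin_comp (brkLG_l _) (brkGG_r _))) (@lin_zero _ _ _) _ => p.
exact: (basis111 (bL := fun m => << m >>) (bG := fun r => << r >>)
          add01E add11E val_inj brkLG_l brkLGU brkGGU).
Qed.

Definition sWitt : lieSuperalgebra K :=
  @LieSuperalgebra K sw_space sw_brk
    (asm_linl brkLL_l brkLG_l brkLG_r brkGG_l)
    (asm_linr brkLL_r brkLG_l brkLG_r brkGG_r)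
    (asm_homog brkLL_l brkLL_r brkLG_l brkLG_r brkGG_l brkGG_r)
    (asm_skew brkLL_l brkLL_r brkLG_l brkLG_r brkGG_l brkGG_r
       brkLL_anti brkGG_sym)
    (asm_jacobi brkLL_l brkLL_r brkLG_l brkLG_r brkGG_l brkGG_r
       brkLL_anti brkGG_sym sw_jac000 sw_jac001 sw_jac011 sw_jac111).

(* The basis vectors L_m and G_r. *)
Definition swL (m : gam 0) : sWitt := (<< m >>, 0).
Definition swG (r : gam 1) : sWitt := (0, << r >>).

Lemma brk_swLL m n : brk (swL m) (swL n) = (val m - val n) *: swL (add00 m n).
Proof.
rewrite -[LHS]/(brkLL << m >> << n >> + brkGG 0 0, brkLG << m >> 0 - brkLG << n >> 0).
rewrite (lin0 (brkGG_r 0)) !(lin0 (brkLG_r _)) addr0 subr0 brkLLU.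
by congr pair; rewrite /= scaler0.
Qed.

Lemma brk_swLG m r : brk (swL m) (swG r) = (val m / 2 - val r) *: swG (add01 m r).
Proof.
rewrite -[LHS]/(brkLL << m >> 0 + brkGG 0 << r >>, brkLG << m >> << r >> - brkLG 0 0).
rewrite (lin0 (brkGG_l _)) (lin0 (brkLL_r _)) (lin0 (brkLG_r _)) addr0 subr0.
by rewrite brkLGU; congr pair; rewrite /= scaler0.
Qed.

Lemma brk_swGG r s : brk (swG r) (swG s) = 2 *: swL (add11 r s).
Proof.
rewrite -[LHS]/(brkLL 0 0 + brkGG << r >> << s >>, brkLG 0 << s >> - brkLG 0 << r >>).
rewrite (lin0 (brkLL_r _)) !(lin0 (brkLG_l _)) add0r subr0 brkGGU.
by congr pair; rewrite /= scaler0.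
Qed.

Definition grp : Type := {x : K * 'Z_2 | x \in Gam}.
HB.instance Definition _ := [isSub of grp for @sval (K * 'Z_2)%type _].
HB.instance Definition _ := [Choice of grp by <:].
HB.instance Definition _ := [SubChoice_isSubZmodule of grp by <:].

Definition gam_grp (i : 'Z_2) (m : gam i) : grp := Sub (val m, i) (valP m).

(* The set of the group homomorphisms from Gam to K^*. *)
Record character := Character {
  chi :> grp -> K;
  chi_neq0 : forall x, chi x != 0;
  chiD : forall x y, chi (x + y) = chi x * chi y }.

Section Omega.
Variables (f : character) (alpha : K).

(* The pair (P, Q) stands for P(L_0) + xi Q(L_0). *)
Definition omega_space : superSpace K := SuperSpace {poly K} {poly K}.

Definition omegaL (m : gam 0) (v : omega_space) : omega_space :=
  let: (P, Q) := v in
  (f (gam_grp m) *: (('X + (val m * alpha)%:P) * (P \Po ('X + (val m)%:P))),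
   f (gam_grp m) *:
     (('X + (val m * (alpha + 1 / 2))%:P) * (Q \Po ('X + (val m)%:P)))).

Definition omegaG (r : gam 1) (v : omega_space) : omega_space :=
  let: (P, Q) := v in
  (f (gam_grp r) *: (('X + (2 * val r * alpha)%:P) * (Q \Po ('X + (val r)%:P))),
   f (gam_grp r) *: (P \Po ('X + (val r)%:P))).

Definition omega_act (x : sw_space) (v : omega_space) : omega_space :=
  lext (omegaL^~ v) x.1 + lext (omegaG^~ v) x.2.

Lemma omegaL_linear m : linear (omegaL m).
Proof.
by move=> c [P Q] [P' Q']; congr pair; exact: (wop_linear _ _ _ c).
Qed.

Lemma omegaG_linear r : linear (omegaG r).
Proof.
move=> c [P Q] [P' Q']; congr pair; first exact: (wop_linear _ _ _ c).
exact: (sclop_linear _ _ c).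
Qed.

Lemma lext_linp (T : choiceType) (V : lmodType K) (h : T -> V -> V) a :
  (forall m, linear (h m)) -> linear (fun v => lext (h^~ v) a).
Proof.
move=> hlin c u v; rewrite /lext scaler_sumr -big_split; apply: eq_bigr => k _ /=.
by rewrite hlin scalerDr !scalerA mulrC.
Qed.

Let EL (a : {malg K[gam 0]}) (v : omega_space) : omega_space := lext (omegaL^~ v) a.
Let EG (b : {malg K[gam 1]}) (v : omega_space) : omega_space := lext (omegaG^~ v) b.

Let EL_l v : linear (EL^~ v). Proof. exact: lext_linear. Qed.
Let EG_l v : linear (EG^~ v). Proof. exact: lext_linear. Qed.
Let EL_r a : linear (EL a). Proof. exact/lext_linp/omegaL_linear. Qed.
Let EG_r b : linear (EG b). Proof. exact/lext_linp/omegaG_linear. Qed.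
Let ELU m v : EL << m >> v = omegaL m v. Proof. exact: lextU. Qed.
Let EGU r v : EG << r >> v = omegaG r v. Proof. exact: lextU. Qed.

Lemma lext_homog (T : choiceType) (V : superSpace K) (h : T -> V) a j :
  (forall k, homog j (h k)) -> homog j (lext h a).
Proof.
move=> hh; rewrite /lext; apply: (big_ind (fun u => homog j u)) => [|u v|k _].
- by rewrite /homog; case: j {hh} => /=.
- by rewrite /homog; case: j {hh} => /= /eqP-> /eqP->; rewrite addr0.
- by have := hh k; rewrite /homog; case: j {hh} => /= /eqP->; rewrite scaler0.
Qed.

Let EL_homog j a v : homog j v -> homog j (EL a v).
Proof.
move=> hv; apply: lext_homog => m; case: v hv => P Q.
by rewrite /homog /=; case: j => /eqP /= ->; rewrite linear0 mulr0 scaler0.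
Qed.

Let EG_homog j b v : homog j v -> homog (~~ j) (EG b v).
Proof.
move=> hv; apply: lext_homog => m; case: v hv => P Q.
by rewrite /homog /=; case: j => /eqP /= ->; rewrite linear0 ?mulr0 scaler0.
Qed.

Let gam_grpD i j k (e : i + j = k) (m : gam i) (n : gam j) :
  f (gam_grp (gam_add e m n)) = f (gam_grp m) * f (gam_grp n).
Proof. by rewrite -chiD; congr (chi f _); apply: val_inj; rewrite /= -e. Qed.

Let omega_LLU (m n : gam 0) v : (val m - val n) *: omegaL (add00 m n) v =
  omegaL m (omegaL n v) - omegaL n (omegaL m v).
Proof.
case: v => P Q; have fE := gam_grpD (addr0 0) m n.
have E b R := omega_LL (f (gam_grp m)) (f (gam_grp n)) (val m) (val n) b R.
by congr pair; [have := E alpha P | have := E (alpha + 1 / 2) Q]; rewrite -fE.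
Qed.

Let omega_LGU (m : gam 0) (r : gam 1) v :
  (val m / 2 - val r) *: omegaG (add01 m r) v =
  omegaL m (omegaG r v) - omegaG r (omegaL m v).
Proof.
case: v => P Q; have fE := gam_grpD (add0r 1) m r.
congr pair.
  have := omega_LG0 (f (gam_grp m)) (f (gam_grp r)) (val m) (val r) alpha Q.
  by rewrite -fE.
have := omega_LG1 (f (gam_grp m)) (f (gam_grp r)) (val m) (val r) alpha P.
by rewrite -fE.
Qed.

Let omega_GGU (r s : gam 1) v : 2 *: omegaL (add11 r s) v =
  omegaG r (omegaG s v) + omegaG s (omegaG r v).
Proof.
case: v => P Q; have fE := gam_grpD gam11_proof r s.
congr pair.
  have := omega_GG0 (f (gam_grp r)) (f (gam_grp s)) (val r) (val s) alpha P.
  by rewrite -fE.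
have := omega_GG1 (f (gam_grp r)) (f (gam_grp s)) (val r) (val s) alpha Q.
by rewrite -fE.
Qed.

Let EL_LL x y v : EL (brkLL x y) v = EL x (EL y v) - EL y (EL x v).
Proof.
move: x; apply: malg_ext (lin_comp (EL_l v) (brkLL_l y))
  (lin_add (EL_l _) (lin_opp (lin_comp (EL_r y) (EL_l v)))) _ => m.
move: y; apply: malg_ext (lin_comp (EL_l v) (brkLL_r _))
  (lin_add (lin_comp (EL_r _) (EL_l v)) (lin_opp (EL_l _))) _ => n.
rewrite brkLLU (linZ (EL_l v)) (ELU (add00 m n)) (ELU m) (ELU n) (ELU m) (ELU n).
exact: omega_LLU.
Qed.

Let EG_LG x y v : EG (brkLG x y) v = EL x (EG y v) - EG y (EL x v).
Proof.
move: x; apply: malg_ext (lin_comp (EG_l v) (brkLG_l y))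
  (lin_add (EL_l _) (lin_opp (lin_comp (EG_r y) (EL_l v)))) _ => m.
move: y; apply: malg_ext (lin_comp (EG_l v) (brkLG_r _))
  (lin_add (lin_comp (EL_r _) (EG_l v)) (lin_opp (EG_l _))) _ => n.
rewrite brkLGU (linZ (EG_l v)) (EGU (add01 m n)) (ELU m) (EGU n) (ELU m) (EGU n).
exact: omega_LGU.
Qed.

Let EL_GG x y v : EL (brkGG x y) v = EG x (EG y v) + EG y (EG x v).
Proof.
move: x; apply: malg_ext (lin_comp (EL_l v) (brkGG_l y))
  (lin_add (EG_l _) (lin_comp (EG_r y) (EG_l v))) _ => m.
move: y; apply: malg_ext (lin_comp (EL_l v) (brkGG_r _))
  (lin_add (lin_comp (EG_r _) (EG_l v)) (EG_l _)) _ => n.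
rewrite brkGGU (linZ (EL_l v)) (ELU (add11 m n)) (EGU m) (EGU n) (EGU m) (EGU n).
exact: omega_GGU.
Qed.

Definition sOmega : smodule sWitt :=
  @Smodule K sWitt omega_space omega_act
    (asm_act_linl EL_l EG_l) (asm_act_linr EL_r EG_r)
    (asm_act_homog EL_l EG_l EL_homog EG_homog)
    (asm_act_brk brkLL_l brkLL_r brkLG_l brkLG_r brkGG_l brkGG_r
       EL_l EG_l EL_LL EG_LG EL_GG).

Lemma sOmega_actL m (v : sOmega) : act (swL m) v = omegaL m v.
Proof.
rewrite -[LHS]/(EL << m >> v + EG 0 v).
by rewrite ELU (lin0 (EG_l v)) addr0.
Qed.

Lemma sOmega_actG r (v : sOmega) : act (swG r) v = omegaG r v.
Proof.
rewrite -[LHS]/(EL 0 v + EG << r >> v).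
by rewrite EGU (lin0 (EL_l v)) add0r.
Qed.

End Omega.

End SWitt.

(* Main.v *)
Require Import Defs.
From HB Require Import structures.
From mathcomp Require Import all_boot all_order all_algebra.
From mathcomp Require Import boolp reals complex.
From mathcomp Require Import ring.
Set Implicit Arguments.
Unset Strict Implicit.
Unset Printing Implicit Defensive.

Import GRing.Theory Num.Theory.
Local Open Scope ring_scope.

(** A graded submodule of [sOmega f alpha] is a pair [(A, B)] of subspaces of
    K[X]. Since [L_0] acts as multiplication by X, both are ideals. The
    operators [L_m], [G_r] multiply by linear factors and shift the variable,
    and a nonzero X-stable subspace that is also stable under P(X) -> P(X + 1)
    is all of K[X]: replacing P by P(X + 1) - P(X) lowers the degree until a
    nonzero constant is reached ([shift_stable_full]).

    The shift comes from products of two odd operators. If s + t = 1 with s, t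
    in Gamma_1, then [G_s G_t] sends an even P, up to a unit, to
    (X + 2 s alpha) P(X + 1), and an odd Q to (X + s + 2 t alpha) Q(X + 1).
    Moving (s, t) to (s + 1, t - 1) leaves the shift alone and changes the linear
    factor by the constant 2 alpha, respectively 1 - 2 alpha. Hence A is
    shift-stable when alpha <> 0 and B is when alpha <> 1/2 ([sub_ev_shift],
    [sub_od_shift]). As each [G_r] is injective, a nonzero submodule has both
    components nonzero, and it follows that

    - for alpha <> 0, A is everything, and then so is B, because [G_r] maps the
      even part onto the odd part ([sOmega_simple]);
    - for alpha = 0, B is everything, and A contains [G_r B] = X K[X]
      ([sOmega0_ker_sub]).

    For alpha = 0 all operators send the whole module into the codimension one
    subspace N = X K[X] + xi K[X], which is therefore a proper submodule with
    trivial quotient, and by the second item it is contained in every nonzero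
    submodule; in particular a simple submodule must equal it. Dividing the even
    part of N by X turns the action into that of
    [Pi_smod (sOmega f (1 / 2))]
    ([sOmega0_act_mulX]), and the latter is simple by the case alpha = 1/2 <> 0. *)

(** * Shift-stable subspaces of polynomials *)

Section Subspaces.
Variables (K : fieldType) (V : lmodType K) (S : {pred V}).
Hypothesis S_closed : submod_closed S.

Lemma submod_addZ c u v : u \in S -> v \in S -> c *: u + v \in S.
Proof. exact: (S_closed.2 c u v). Qed.

Lemma submod_scale c u : c != 0 -> (c *: u \in S) = (u \in S).
Proof.
move=> c0; have clZ a w : w \in S -> a *: w \in S.
  by move=> wS; rewrite -[a *: w]addr0; apply: submod_addZ => //; case: S_closed.
apply/idP/idP=> [/(clZ c^-1)|/(clZ c) //].
by rewrite scalerA mulVf // scale1r.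
Qed.

Lemma submod_sub u v : u \in S -> v \in S -> u - v \in S.
Proof. by move=> hu hv; rewrite addrC -scaleN1r; apply: submod_addZ. Qed.

End Subspaces.

Section ShiftStable.
Variable K : numFieldType.
Implicit Types P Q : {poly K}.

Lemma shiftK c : cancel (@shift_poly K c) (shift_poly (- c)).
Proof. by move=> P; rewrite shift_polyD addNr /shift_poly addr0 comp_polyXr. Qed.

Lemma shift_neq0 c P : P != 0 -> shift_poly c P != 0.
Proof.
by apply: contra_neq => P0; rewrite -[P](shiftK c) P0 linear0.
Qed.

(** Two multiples of [P] by linear factors with different constant terms
    differ by a nonzero scalar multiple of [P]. *)
Lemma submod_lin_factors (S : {pred {poly K}}) (a b : K) P :
  submod_closed S -> a != b ->
  ('X + a%:P) * P \in S -> ('X + b%:P) * P \in S -> P \in S.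
Proof.
move=> S_closed ab ha hb; have ab0 : a - b != 0 by rewrite subr_eq0.
rewrite -(submod_scale S_closed _ ab0).
rewrite -mul_polyC polyCB (_ : _ * P = ('X + a%:P) * P - ('X + b%:P) * P).
  exact: submod_sub.
by ring.
Qed.

(** A polynomial fixed by the shift takes the value [P.[0]] at every natural
    number, which is too often for a nonconstant polynomial. *)
Lemma shift_fixed_const P : shift_poly 1 P = P -> P = (P.[0])%:P.
Proof.
move=> PE; have Pn n : P.[n%:R] = P.[0].
  elim: n => // n IHn; rewrite -IHn -[in RHS]PE /shift_poly horner_comp.
  by rewrite hornerD hornerX hornerC -natr1.
apply/eqP; rewrite -subr_eq0; apply/eqP.
set Q := P - _.
apply: (@roots_geq_poly_eq0 _ Q [seq n%:R | n <- iota 0 (size Q)]).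
- apply/allP=> _ /mapP[n _ ->].
  by rewrite /root /Q hornerD hornerN hornerC Pn subrr.
- by rewrite map_inj_uniq ?iota_uniq // => m n /eqP; rewrite eqr_nat => /eqP.
- by rewrite size_map size_iota.
Qed.

(** The shift preserves the degree and the leading coefficient, so the leading
    terms cancel. *)
Lemma size_shift_sub c P : P != 0 ->
  (size (shift_poly c P - P)%R < size P)%N.
Proof.
move=> P0; have sX : size ('X + c%:P) = 2%N by rewrite size_XaddC.
have sP : size (shift_poly c P) = size P by rewrite size_comp_poly2.
have lP : lead_coef (shift_poly c P) = lead_coef P.
  by rewrite lead_coef_comp ?sX // lead_coefXaddC expr1n mulr1.
have sP_gt0 : (0 < size P)%N by rewrite size_poly_gt0.
rewrite -(prednK sP_gt0) ltnS; apply/leq_sizeP => j.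
rewrite leq_eqVlt => /orP[/eqP <-|].
  move: lP; rewrite !lead_coefE sP coefB => ->; exact: subrr.
by rewrite -ltnS prednK // ltnS => jP; rewrite coefB !nth_default ?sP ?subrr.
Qed.

(** By induction on the degree of [P]: the difference of [P] and its shift has
    smaller degree, and it vanishes only if [P] is a constant, whose multiples
    by powers of 'X span everything. *)
Lemma shift_stable_full (S : {pred {poly K}}) : submod_closed S ->
  (forall P, P \in S -> 'X * P \in S) ->
  (forall P, P \in S -> shift_poly 1 P \in S) ->
  forall P, P \in S -> P != 0 -> forall Q, Q \in S.
Proof.
move=> S_closed mulX shift P; have [n] := ubnP (size P).
elim: n P => // n IHn P ltPn PS P0 Q.
have [/eqP|D0] := eqVneq (shift_poly 1 P - P) 0.
  rewrite subr_eq0 => /eqP /shift_fixed_const PE.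
  move: PS P0; rewrite PE polyC_eq0 -[_%:P]mulr1 mul_polyC => cS c0.
  rewrite submod_scale // in cS.
  elim/poly_ind: Q => [|Q c QS]; first by case: S_closed.
  rewrite addrC -[c%:P]mulr1 mul_polyC.
  by apply: submod_addZ; rewrite // mulrC; apply: mulX.
apply: (IHn _ _ _ D0); last by apply: submod_sub => //; apply: shift.
by rewrite -ltnS; apply: leq_trans ltPn; apply: size_shift_sub.
Qed.

End ShiftStable.

(** * Submodules and morphisms of graded modules *)

Section Morphisms.
Variables (K : fieldType) (g : lieSuperalgebra K).
Implicit Types M N : smodule g.

Lemma mem_submodE M (S : submodule M) (v : M) :
  (v \in mem_submod S) = (v.1 \in sub_ev S) && (v.2 \in sub_od S).
Proof. by []. Qed.

Lemma submod_zeroVnz M (S : submodule M) :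
  (forall v : M, v \in mem_submod S -> v = 0) \/
  (exists2 v : M, v \in mem_submod S & v != 0).
Proof.
have [|S0] := pselect (exists2 v : M, v \in mem_submod S & v != 0); first by right.
by left=> v vS; apply: contra_notP S0 => /eqP v0; exists v.
Qed.

Lemma quot_pi_eq0 M (S : submodule M) (v : M) :
  (quot_pi S v == 0) = (v \in mem_submod S).
Proof.
rewrite -pair_eqE /= /pair_eq /=.
by rewrite -!(raddf0 (lquot_pi _)) !lquot_piP !subr0.
Qed.

Section Preimage.
Variables (M N : smodule g).
Variables (phi0 : {linear evp M -> evp N}) (phi1 : {linear odp M -> odp N}).
Hypothesis phi_act : forall (x : g) (v : M),
  (phi0 (act x v).1, phi1 (act x v).2) = act x (phi0 v.1, phi1 v.2).
Variable S : submodule N.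

Lemma preim_closed (V W : lmodType K) (h : {linear V -> W}) (A : {pred W}) :
  submod_closed A -> submod_closed [pred v | h v \in A].
Proof.
move=> [A0 AZ]; split; first by rewrite inE linear0.
by move=> c u v; rewrite !inE linearP; exact: AZ.
Qed.

Lemma preim_act (x : g) (v : M) : phi0 v.1 \in sub_ev S -> phi1 v.2 \in sub_od S ->
  (phi0 (act x v).1 \in sub_ev S) && (phi1 (act x v).2 \in sub_od S).
Proof.
move=> h0 h1; have := @sub_act _ _ _ S x (phi0 v.1, phi1 v.2) h0 h1.
by rewrite -phi_act.
Qed.

Definition preim_submod : submodule M :=
  Submodule (preim_closed phi0 (sub_ev_closed S))
    (preim_closed phi1 (sub_od_closed S)) preim_act.

Lemma mem_preim (v : M) :
  (v \in mem_submod preim_submod) = ((phi0 v.1, phi1 v.2) \in mem_submod S).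
Proof. by []. Qed.

End Preimage.

(** The inverses of bijective linear maps are linear, and they inherit the
    compatibility with the action. *)
Lemma iso_smod_sym M N : iso_smod M N -> iso_smod N M.
Proof.
case=> phi0 [phi1] [[psi0 K0 K0'] [psi1 K1 K1'] phi_act].
pose lin0 := GRing.isLinear.Build K (evp N) (evp M) *:%R psi0
  (can2_linear K0 K0').
pose lin1 := GRing.isLinear.Build K (odp N) (odp M) *:%R psi1
  (can2_linear K1 K1').
pose Psi0 : {linear evp N -> evp M} := HB.pack psi0 lin0.
pose Psi1 : {linear odp N -> odp M} := HB.pack psi1 lin1.
exists Psi0, Psi1; split; [by exists phi0 | by exists phi1 |].
move=> x [a b]; have := phi_act x (psi0 a, psi1 b).
by rewrite /= K0' K1' => <- /=; rewrite K0 K1; case: (act x _).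
Qed.

Lemma simple_iso M N : iso_smod M N -> simple_smod M -> simple_smod N.
Proof.
case=> phi0 [phi1] [[psi0 K0 K0'] [psi1 K1 K1'] phi_act] [[[a b] ab0] simM].
split.
  exists (phi0 a, phi1 b); apply: contra ab0.
  rewrite -!pair_eqE /= => /andP[/eqP ha /eqP hb].
  by rewrite -[a]K0 -[b]K1 ha hb -[in X in psi0 X](linear0 phi0)
    -[in X in psi1 X](linear0 phi1) K0 K1 !eqxx.
move=> S; have [S0|ST] := simM (preim_submod phi_act S); [left|right] => -[c d].
  move=> cdS; have := S0 (psi0 c, psi1 d); rewrite mem_preim /= K0' K1'.
  by move=> /(_ cdS) [hc hd]; rewrite -[c]K0' -[d]K1' hc hd !linear0.
by have := ST (psi0 c, psi1 d); rewrite mem_preim /= K0' K1'.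
Qed.

Lemma simple_Pi M : simple_smod M -> simple_smod (Pi_smod M).
Proof.
case=> [[[a b] ab0] simM]; split.
  by exists (b, a); move: ab0; rewrite -!pair_eqE /= andbC.
case=> A B cA cB AB_act; have BA_act (x : g) (v : M) :
    v.1 \in B -> v.2 \in A -> ((act x v).1 \in B) && ((act x v).2 \in A).
  move=> v1 v2; have := AB_act x (v.2, v.1) v2 v1.
  by rewrite andbC /= /Pi_act /=; case: v {v1 v2}.
have [S0|ST] := simM (Submodule cB cA BA_act); [left|right] => -[c d].
  rewrite mem_submodE /= => /andP[cA' dB]; have := S0 (d, c).
  by rewrite mem_submodE /= cA' dB => /(_ isT) [-> ->].
by have := ST (d, c); rewrite !mem_submodE andbC.
Qed.

(** The preimage of [N] under the inclusion of [N'] is a nonzero submodule of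
    the simple module [N']. *)
Lemma simple_sub_eq M (N N' : submodule M) : simple_smod (sub_smod N') ->
  {subset mem_submod N <= mem_submod N'} ->
  (exists2 v : M, v \in mem_submod N & v != 0) ->
  mem_submod N' =i mem_submod N.
Proof.
move=> [_ simN'] NN' [[a b] abN ab0].
pose i0 : {linear evp (sub_smod N') -> evp M} := val.
pose i1 : {linear odp (sub_smod N') -> odp M} := val.
have incl_act (x : g) (v : sub_smod N') :
  (i0 (act x v).1, i1 (act x v).2) = act x (i0 v.1, i1 v.2) := sub_smod_actE x v.
have lift c d : (c, d) \in mem_submod N' ->
    exists v : sub_smod N', (i0 v.1, i1 v.2) = (c, d).
  by move=> /andP[/= hc hd]; exists (exist _ c hc, exist _ d hd).
have [S0|ST] := simN' (preim_submod incl_act N).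
  have [v vab] := lift _ _ (NN' _ abN).
  have /S0 v0 : v \in mem_submod (preim_submod incl_act N).
    by rewrite mem_preim vab.
  by move: ab0; rewrite -vab v0 (linear0 i0) (linear0 i1) eqxx.
case=> c d; apply/idP/idP => [/lift[v vcd]|]; last exact: NN'.
by have := ST v; rewrite mem_preim vcd.
Qed.

End Morphisms.

(** * Modules over the super Witt algebra *)

Section SWittModules.
Variables (K : numFieldType) (Gam : zmodClosed (K * 'Z_2)%type).

(** Reduces identities for the action of an arbitrary element to the basis
    vectors [L_m] and [G_r], on which the action is explicit. *)
Lemma sWitt_ext (V : lmodType K) (F G : sWitt Gam -> V) :
  linear F -> linear G -> (forall m, F (swL m) = G (swL m)) ->
  (forall r, F (swG r) = G (swG r)) -> F =1 G.
Proof.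
move=> linF linG FGL FGG [a b].
have -> : (a, b) = 1 *: ((a, 0) : sWitt Gam) + (0, b).
  by rewrite scale1r; congr pair; rewrite /= ?addr0 ?add0r.
rewrite linF linG; congr (_ *: _ + _).
  have inj : linear (fun a => (a, 0) : sWitt Gam).
    by move=> c u v; congr pair; rewrite /= scaler0 addr0.
  exact: (malg_ext (lin_comp linF inj) (lin_comp linG inj) FGL).
have inj : linear (fun b => (0, b) : sWitt Gam).
  by move=> c u v; congr pair; rewrite /= scaler0 addr0.
exact: (malg_ext (lin_comp linF inj) (lin_comp linG inj) FGG).
Qed.

End SWittModules.

Section Omega.
Variables (K : numFieldType) (Gam : zmodClosed (K * 'Z_2)%type).
Hypothesis one_even : (1, 0) \in Gam.
Variables (r0 : K) (r0_odd : (r0, 1) \in Gam) (f : character Gam).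

(** The opposite of the odd parity is odd, as - 1 = 1 in 'Z_2. *)
Lemma odd_opp r : (r, 1) \in Gam -> (- r, 1) \in Gam.
Proof.
move=> hr; have -> : (- r, 1) = - ((r, 1) : K * 'Z_2).
  by congr pair; apply: val_inj.
by rewrite rpredN.
Qed.

Lemma odd_add1 r : (r, 1) \in Gam -> (r + 1, 1) \in Gam.
Proof.
move=> hr; have := rpredD hr one_even.
by rewrite -[(r, 1) + (1, 0)]/(r + 1, 1 + 0) addr0.
Qed.

(** * Graded submodules of Omega *)

Section Stability.
Variables (alpha : K) (N : submodule (sOmega f alpha)).
Implicit Types P Q : {poly K}.

(** The operators carry the scalars [f m] and [f r]; these are units, so they
    can be dropped in membership statements. *)
Lemma sub_ev_L m P : (m, 0) \in Gam -> P \in sub_ev N ->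
  ('X + (m * alpha)%:P) * (shift_poly m P) \in sub_ev N.
Proof.
move=> hm PN; pose m' : gam Gam 0 := Sub m hm.
have := @sub_act _ _ _ N (swL m') (P, 0) PN (sub_od_closed N).1.
by rewrite sOmega_actL /= (submod_scale (sub_ev_closed N)) ?chi_neq0 // => /andP[].
Qed.

Lemma sub_od_L m Q : (m, 0) \in Gam -> Q \in sub_od N ->
  ('X + (m * (alpha + 1 / 2))%:P) * (shift_poly m Q) \in sub_od N.
Proof.
move=> hm QN; pose m' : gam Gam 0 := Sub m hm.
have := @sub_act _ _ _ N (swL m') (0, Q) (sub_ev_closed N).1 QN.
by rewrite sOmega_actL /= (submod_scale (sub_od_closed N)) ?chi_neq0 // => /andP[].
Qed.

Lemma sub_od_G r P : (r, 1) \in Gam -> P \in sub_ev N ->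
  shift_poly r P \in sub_od N.
Proof.
move=> hr PN; pose r' : gam Gam 1 := Sub r hr.
have := @sub_act _ _ _ N (swG r') (P, 0) PN (sub_od_closed N).1.
by rewrite sOmega_actG /= (submod_scale (sub_od_closed N)) ?chi_neq0 // => /andP[].
Qed.

Lemma sub_ev_G r Q : (r, 1) \in Gam -> Q \in sub_od N ->
  ('X + (2 * r * alpha)%:P) * (shift_poly r Q) \in sub_ev N.
Proof.
move=> hr QN; pose r' : gam Gam 1 := Sub r hr.
have := @sub_act _ _ _ N (swG r') (0, Q) (sub_ev_closed N).1 QN.
by rewrite sOmega_actG /= (submod_scale (sub_ev_closed N)) ?chi_neq0 // => /andP[].
Qed.

(** [L_0] is multiplication by 'X. *)
Lemma sub_ev_X P : P \in sub_ev N -> 'X * P \in sub_ev N.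
Proof.
by move/(sub_ev_L (rpred0 Gam)); rewrite mul0r addr0 /shift_poly addr0 comp_polyXr.
Qed.

Lemma sub_od_X Q : Q \in sub_od N -> 'X * Q \in sub_od N.
Proof.
by move/(sub_od_L (rpred0 Gam)); rewrite mul0r addr0 /shift_poly addr0 comp_polyXr.
Qed.

Lemma sub_ev_GG s t P : (s, 1) \in Gam -> (t, 1) \in Gam -> P \in sub_ev N ->
  ('X + (2 * s * alpha)%:P) * (shift_poly (s + t) P) \in sub_ev N.
Proof.
move=> hs ht PN; have := sub_ev_G hs (sub_od_G ht PN).
by rewrite shift_polyD.
Qed.

Lemma sub_od_GG s t Q : (s, 1) \in Gam -> (t, 1) \in Gam -> Q \in sub_od N ->
  ('X + (s + 2 * t * alpha)%:P) * (shift_poly (s + t) Q) \in sub_od N.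
Proof.
move=> hs ht QN; have := sub_od_G hs (sub_ev_G ht QN).
by rewrite shift_polyM shift_lin shift_polyD -addrA -polyCD.
Qed.

(** Compares [G_s G_t] for (s, t) = (r0 + 1, - r0) and (r0, 1 - r0). Both shift
    by 1, and the linear factors differ by 2 alpha. *)
Lemma sub_ev_shift P : alpha != 0 -> P \in sub_ev N ->
  shift_poly 1 P \in sub_ev N.
Proof.
move=> a0 PN; set t := - r0.
have [hr1 ht] := (odd_add1 r0_odd, odd_opp r0_odd).
have h1 := sub_ev_GG hr1 ht PN; have h2 := sub_ev_GG r0_odd (odd_add1 ht) PN.
rewrite (_ : r0 + (t + 1) = 1) in h2; last by rewrite addrA subrr add0r.
rewrite (_ : r0 + 1 + t = 1) in h1; last by rewrite addrAC subrr add0r.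
apply: (submod_lin_factors (sub_ev_closed N) _ h1 h2).
rewrite -subr_eq0 (_ : _ - _ = 2 * alpha); last by ring.
by rewrite mulf_neq0 ?pnatr_eq0.
Qed.

(** For the same two pairs (s, t), the linear factors on the odd part differ by
    1 - 2 alpha. *)
Lemma sub_od_shift Q : 2 * alpha != 1 -> Q \in sub_od N ->
  shift_poly 1 Q \in sub_od N.
Proof.
move=> a1 QN; set t := - r0.
have [hr1 ht] := (odd_add1 r0_odd, odd_opp r0_odd).
have h1 := sub_od_GG hr1 ht QN; have h2 := sub_od_GG r0_odd (odd_add1 ht) QN.
rewrite (_ : r0 + (t + 1) = 1) in h2; last by rewrite addrA subrr add0r.
rewrite (_ : r0 + 1 + t = 1) in h1; last by rewrite addrAC subrr add0r.
apply: (submod_lin_factors (sub_od_closed N) _ h1 h2).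
rewrite -subr_eq0 (_ : _ - _ = 1 - 2 * alpha); last by ring.
by rewrite subr_eq0 eq_sym.
Qed.

Lemma sub_ev_full P : alpha != 0 -> P \in sub_ev N -> P != 0 ->
  forall Q, Q \in sub_ev N.
Proof.
move=> a0; apply: (shift_stable_full (sub_ev_closed N) sub_ev_X) => Q.
exact: sub_ev_shift.
Qed.

Lemma sub_od_full Q : 2 * alpha != 1 -> Q \in sub_od N -> Q != 0 ->
  forall P, P \in sub_od N.
Proof.
move=> a1; apply: (shift_stable_full (sub_od_closed N) sub_od_X) => P.
exact: sub_od_shift.
Qed.

End Stability.

(** * Simplicity for nonzero alpha *)

Lemma sOmega_neq0 alpha : exists v : sOmega f alpha, v != 0.
Proof. by exists (1, 0); rewrite -pair_eqE /= oner_eq0. Qed.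

Lemma sOmega_simple alpha : alpha != 0 -> simple_smod (sOmega f alpha).
Proof.
move=> a0; split=> [|N]; first exact: sOmega_neq0.
have [|[[P Q] /andP[/= PN QN] PQ0]] := submod_zeroVnz N; first by left.
(* If the even part of the given vector vanishes, [G_r0] moves the odd one into it. *)
have evT : forall R, R \in sub_ev N.
  have [P0|] := eqVneq P 0; last exact: sub_ev_full.
  apply: (sub_ev_full a0 (sub_ev_G r0_odd QN)).
  rewrite mulf_neq0 //; first by rewrite -size_poly_eq0 size_XaddC.
  by apply: shift_neq0; move: PQ0; rewrite -pair_eqE P0 /= eqxx.
(* Every odd [B] is a shift by [r0], hence the image of an even vector. *)
right=> -[A B]; apply/andP; split=> //=.
by rewrite -[B](shiftK (- r0)) opprK; exact: sub_od_G.
Qed.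

(** * The submodule of the case alpha = 0 *)

(** The odd component is shift-stable, as 2 alpha = 0 differs from 1, and it is
    nonzero since [G_r] is injective; so it is everything. Then [G_r] produces
    all multiples of 'X in the even component. *)
Lemma sOmega0_ker_sub (N : submodule (sOmega f 0)) (v : sOmega f 0) :
  v \in mem_submod N -> v != 0 ->
  forall w : sOmega f 0, root w.1 0 -> w \in mem_submod N.
Proof.
case: v => P Q /andP[/= PN QN] PQ0 [A B] /factor_theorem[C /= ->].
have odT : forall R, R \in sub_od N.
  have a1 : 2 * 0 != 1 :> K by rewrite mulr0 eq_sym oner_eq0.
  have [Q0|] := eqVneq Q 0; last exact: sub_od_full.
  apply: (sub_od_full a1 (sub_od_G r0_odd PN)).
  by apply: shift_neq0; move: PQ0; rewrite -pair_eqE Q0 /= eqxx andbT.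
apply/andP; split=> //=; rewrite subr0 mulrC -[C](shiftK (- r0)) opprK.
by have := sub_ev_G r0_odd (odT (shift_poly (- r0) C)); rewrite mulr0 addr0.
Qed.

(** At alpha = 0 the even component of every [L_m v] and [G_r v] has the factor
    'X. Hence X K[X] + xi K[X] is a submodule and the quotient by it is
    trivial. *)
Lemma sOmega0_act_root (x : sWitt Gam) (v : sOmega f 0) : root (act x v).1 0.
Proof.
apply/eqP; pose F y : K^o := (act y v).1.[0].
apply: (@sWitt_ext _ _ _ F (fun=> 0)) => [c y z||m|r].
- by rewrite /F act_linl /= hornerD hornerZ.
- exact: lin_zero.
- case: v @F => P Q F; rewrite /F sOmega_actL /= mulr0 addr0.
  by rewrite hornerZ hornerM hornerX mul0r mulr0.
- case: v @F => P Q F; rewrite /F sOmega_actG /= mulr0 addr0.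
  by rewrite hornerZ hornerM hornerX mul0r mulr0.
Qed.

Lemma root0_closed : submod_closed [pred P : {poly K} | root P 0].
Proof.
split=> [|c P Q]; rewrite !inE ?root0 // => /rootP P0 /rootP Q0.
by apply/rootP; rewrite hornerD hornerZ P0 Q0 mulr0 addr0.
Qed.

Lemma predT_closed (V : lmodType K) : submod_closed (predT : {pred V}).
Proof. by []. Qed.

Lemma sOmega0_ker_act (x : sWitt Gam) (v : sOmega f 0) :
  v.1 \in [pred P : {poly K} | root P 0] -> v.2 \in (predT : {pred {poly K}}) ->
  ((act x v).1 \in [pred P : {poly K} | root P 0]) &&
  ((act x v).2 \in (predT : {pred {poly K}})).
Proof. by move=> _ _; rewrite inE sOmega0_act_root. Qed.

Definition sOmega0_ker : submodule (sOmega f 0) :=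
  @Submodule _ _ (sOmega f 0) _ _ root0_closed (@predT_closed _) sOmega0_ker_act.

Lemma mem_sOmega0_ker (v : sOmega f 0) :
  (v \in mem_submod sOmega0_ker) = root v.1 0.
Proof. by rewrite mem_submodE andbT. Qed.

Lemma sOmega0_not_simple : ~ simple_smod (sOmega f 0).
Proof.
case=> _ /(_ sOmega0_ker) [N0|NT].
  have := N0 (0, 1); rewrite mem_sOmega0_ker root0 => /(_ isT) [/eqP].
  by rewrite oner_eq0.
by have := NT (1, 0); rewrite mem_sOmega0_ker; apply/negP; exact: root1.
Qed.

Lemma sOmega0_simple_sub_eq_ker (N' : submodule (sOmega f 0)) :
  simple_smod (sub_smod N') -> mem_submod N' =i mem_submod sOmega0_ker.
Proof.
move=> simN'; apply: simple_sub_eq => // [v|].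
  rewrite mem_sOmega0_ker; case: simN' => [[u u0] _].
  apply: (@sOmega0_ker_sub N' (sub_incl u)).
    exact: (introT andP (conj (valP u.1) (valP u.2))).
  by apply: contra_neq u0 => u0; apply: sub_incl_inj; rewrite u0.
exists (0, 1); first by rewrite mem_sOmega0_ker root0.
by rewrite -pair_eqE /= oner_eq0 andbF.
Qed.

(** Evaluation of the even component at 0 identifies the quotient with the base
    field. *)
Lemma sOmega0_quot_trivial : trivial_smod (quot_smod sOmega0_ker).
Proof.
have pi_eq0 (v : sOmega f 0) : (quot_pi sOmega0_ker v == 0) = root v.1 0.
  by rewrite quot_pi_eq0 mem_sOmega0_ker.
split.
  exists (quot_pi sOmega0_ker (1, 0)); first by rewrite pi_eq0 root1.
  move=> q; rewrite -[q]quot_reprK; case: (quot_repr q) => P Q.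
  exists P.[0]; apply/eqP; rewrite -subr_eq0 -scaleNr addrC.
  rewrite -(quot_pi_linear sOmega0_ker) pi_eq0 /= /root.
  by rewrite hornerD hornerZ hornerC mulr1 addNr.
move=> x q; apply/eqP; rewrite -[q]quot_reprK.
by rewrite [act _ _]quot_smod_actE pi_eq0 sOmega0_act_root.
Qed.

(** The shift by m turns P * 'X into P(X + m) * ('X + m), and the new factor is
    the one with which [L_m] acts on the odd part for alpha = 1/2, where
    m (1/2 + 1/2) = m. On a multiple of 'X, [G_r] likewise gains the factor
    'X + r = 'X + 2 r (1/2) of [G_r] on the odd part for alpha = 1/2, while the
    factor 'X of [G_r] on the odd part for alpha = 0 is the one divided out. *)
Lemma sOmega0_act_mulX (x : sWitt Gam) (P Q : {poly K}) :
  act x ((P * 'X, Q) : sOmega f 0) =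
  let w := act x ((Q, P) : sOmega f (1 / 2)) in (w.2 * 'X, w.1).
Proof.
pose G y : sOmega f 0 :=
  let w := act y ((Q, P) : sOmega f (1 / 2)) in (w.2 * 'X, w.1).
pose F y := act y ((P * 'X, Q) : sOmega f 0).
rewrite -[LHS]/(F x) -[RHS]/(G x); apply: sWitt_ext => [||m|r]; rewrite {}/F {}/G.
- exact: act_linl.
- by move=> c y z; rewrite act_linl /= mulrDl -scalerAl.
- rewrite !sOmega_actL /omegaL comp_polyM comp_polyX.
  congr pair; rewrite -?scalerAl ?mulr0 ?addr0; congr (_ *: _).
    have -> : 1 / 2 + 1 / 2 = 1 :> K by field.
    by rewrite mulr1; ring.
  by rewrite add0r.
- rewrite !sOmega_actG /omegaG comp_polyM comp_polyX.
  congr pair; rewrite -?scalerAl ?mulr0 ?addr0; congr (_ *: _); first by rewrite mulrC.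
  have -> : 2 * val r * (1 / 2) = val r by field.
  by rewrite mulrC.
Qed.

Lemma sOmega0_ker_iso : iso_smod (sub_smod sOmega0_ker) (Pi_smod (sOmega f (1 / 2))).
Proof.
pose phi0 : {linear evp (sub_smod sOmega0_ker) -> {poly K}} := drop_poly 1 \o val.
pose phi1 : {linear odp (sub_smod sOmega0_ker) -> {poly K}} := val.
have rootX Q : Q * 'X \in sub_ev sOmega0_ker.
  by rewrite inE /root hornerM hornerX mulr0.
have dropX Q : drop_poly 1 (Q * 'X) = Q by rewrite -['X]expr1 drop_polyMXn_id.
have rootE (P : lsub (sub_ev_closed sOmega0_ker)) : val P = phi0 P * 'X.
  case: P => P rP; have /factor_theorem[C /= ->] : root P 0 := rP.
  by rewrite subr0 /phi0 /= dropX.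
exists phi0, phi1; split.
- exists (fun Q => exist _ (Q * 'X) (rootX Q)) => [P|Q]; last exact: dropX.
  by apply: val_inj; exact: esym (rootE P).
- by exists (fun Q => exist _ Q isT) => [[Q rQ]|Q] //; apply: val_inj.
move=> x [P Q]; rewrite -[LHS]/(drop_poly 1 (act x (sub_incl (P, Q))).1,
  (act x (sub_incl (P, Q))).2).
have -> : sub_incl (P, Q) = (phi0 P * 'X, val Q) by rewrite -rootE.
by rewrite (sOmega0_act_mulX x (phi0 P) (val Q)) /= dropX.
Qed.
End Omega.

Theorem theorem4p4 (R : realType) (Gam : zmodClosed (R[i] * 'Z_2)%type)
    (Gam0_1 : (1, 0) \in Gam) (Gam1_neq0 : exists r : R[i], (r, 1) \in Gam)
    (f : character Gam) (alpha : R[i]) :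
  (simple_smod (sOmega f alpha) <-> alpha <> 0) /\
  (exists N : submodule (sOmega f 0),
     [/\ simple_smod (sub_smod N),
         forall N' : submodule (sOmega f 0),
           simple_smod (sub_smod N') -> mem_submod N' =i mem_submod N,
         iso_smod (sub_smod N) (Pi_smod (sOmega f (1 / 2))) &
         trivial_smod (quot_smod N)]).
Proof.
case: Gam1_neq0 => r0 r0_odd; split.
  split=> [simO a0|/eqP]; last exact: (sOmega_simple Gam0_1 r0_odd).
  by apply: (@sOmega0_not_simple _ _ f); rewrite -a0.
have half0 : 1 / 2 != 0 :> R[i] by rewrite mul1r invr_eq0 pnatr_eq0.
exists (sOmega0_ker f); split.
- apply: simple_iso (iso_smod_sym (sOmega0_ker_iso f)) _.
  exact/simple_Pi/(sOmega_simple Gam0_1 r0_odd).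
- by move=> N' simN'; apply: (sOmega0_simple_sub_eq_ker Gam0_1 r0_odd).
- exact: sOmega0_ker_iso.
- exact: sOmega0_quot_trivial.
Qed.
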